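(* Let $R$ be a commutative noetherian ring and let $M$ be an $R$-module. The following statements are equivalent: (i) $M$ is a minimax $R$-module. (ii) $M_{\mathfrak m}$ is a minimax $R_{\mathfrak m}$-module for every maximal ideal $\mathfrak m$ of $R$, and $M$ is a weakly laskerian $R$-module.
   Context: A module $M$ over a commutative noetherian ring is minimax if it has a finitely generated submodule $N$ such that $M/N$ is artinian. A module $M$ is weakly laskerian if for every submodule $N\subset M$ the quotient $M/N$ has only finitely many associated primes. *)

(* Defs.v *)
From HB Require Import structures.
From mathcomp Require Import all_boot all_algebra ring.
From mathcomp Require Import boolp classical_sets cardinality.

Set Implicit Arguments.
Unset Strict Implicit.
Unset Printing Implicit Defensive.

Import GRing.Theory.
Local Open Scope quotient_scope.
Local Open Scope ring_scope.

(* Rings are [comPzRingType]s, so the zero ring is allowed.  Submodules are    *)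
(* boolean predicates; by excluded middle (boolp) this is no restriction.      *)

Section Submodules.
Variables (R : comPzRingType) (M : lmodType R).

Record submodule := Submodule {
  submodule_fun : M -> bool;
  submodule_subproof : submod_closed submodule_fun
}.

(* A field of type [{pred M}] would put [submodule] in a universe too high for *)
(* [set].                                                                      *)
Coercion submodule_pred (N : submodule) : {pred M} := submodule_fun N.

Lemma submoduleP (N : submodule) : submod_closed N.
Proof. exact: submodule_subproof. Qed.

HB.instance Definition _ (N : submodule) :=
  GRing.isSubmodClosed.Build R M (submodule_pred N)
    (submoduleP N).

Definition fg_submodule (N : submodule) : Prop :=
  exists n (g : 'I_n -> M), forall x : M,
    x \in N <-> exists c : 'I_n -> R, x = \sum_(i < n) c i *: g i.

Definition noetherian_module : Prop :=
  forall N : nat -> submodule, (forall i, {subset N i <= N i.+1}) ->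
  exists n, forall k, (n <= k)%N -> N k =i N n.

Definition artinian_module : Prop :=
  forall N : nat -> submodule, (forall i, {subset N i.+1 <= N i}) ->
  exists n, forall k, (n <= k)%N -> N k =i N n.

End Submodules.

Section QuotientModule.
Variables (R : comPzRingType) (M : lmodType R) (N : submodule M).

Definition quotmod : Type := Quotient.quot (submodule_pred N : zmodClosed M).

HB.instance Definition _ := Choice.on quotmod.
HB.instance Definition _ := GRing.Zmodule.on quotmod.
HB.instance Definition _ :=
  EqQuotient.copy quotmod (Quotient.quot (submodule_pred N : zmodClosed M)).

Definition quotmod_pi (x : M) : quotmod := \pi_quotmod x.

Lemma quotmod_piP (x y : M) : quotmod_pi x = quotmod_pi y <-> x - y \in N.
Proof.
rewrite -[x - y \in N]/(Quotient.equiv (submodule_pred N : zmodClosed M) x y).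
by split=> [/eqmodP|h] //; apply/eqmodP.
Qed.

Lemma quotmod_pi_surj (u : quotmod) : exists x, u = quotmod_pi x.
Proof. by exists (repr u); rewrite /quotmod_pi reprK. Qed.

Lemma quotmod_piD : {morph quotmod_pi : x y / x + y}.
Proof. by move=> x y; apply: (@Quotient.pi_add M (submodule_pred N)). Qed.

Definition quotmod_scale (a : R) (u : quotmod) : quotmod :=
  quotmod_pi (a *: repr u).

Lemma quotmod_piZ a x : quotmod_scale a (quotmod_pi x) = quotmod_pi (a *: x).
Proof.
apply/quotmod_piP; rewrite -scalerBr; apply: rpredZ.
by apply/quotmod_piP; rewrite /quotmod_pi reprK.
Qed.

Lemma quotmod_scaleA a b u :
  quotmod_scale a (quotmod_scale b u) = quotmod_scale (a * b) u.
Proof. by have [x ->] := quotmod_pi_surj u; rewrite !quotmod_piZ scalerA. Qed.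

Lemma quotmod_scale1 : left_id 1 quotmod_scale.
Proof.
by move=> u; have [x ->] := quotmod_pi_surj u; rewrite quotmod_piZ scale1r.
Qed.

Lemma quotmod_scaleDr : right_distributive quotmod_scale +%R.
Proof.
move=> a u v; have [x ->] := quotmod_pi_surj u.
have [y ->] := quotmod_pi_surj v.
by rewrite -quotmod_piD !quotmod_piZ -quotmod_piD scalerDr.
Qed.

Lemma quotmod_scaleDl u : {morph quotmod_scale^~ u : a b / a + b}.
Proof.
move=> a b; have [x ->] := quotmod_pi_surj u.
by rewrite !quotmod_piZ -quotmod_piD scalerDl.
Qed.

HB.instance Definition _ := GRing.Zmodule_isLmodule.Build R quotmod
  quotmod_scaleA quotmod_scale1 quotmod_scaleDr quotmod_scaleDl.

End QuotientModule.

Section Ideals.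
Variable R : comPzRingType.

Definition ideal := submodule R^o.

Definition prime_ideal (p : ideal) : Prop :=
  1 \notin p /\ forall a b : R, a * b \in p -> a \in p \/ b \in p.

Definition maximal_ideal (m : ideal) : Prop :=
  1 \notin m /\
  forall I : ideal, {subset m <= I} -> 1 \notin I -> {subset I <= m}.

Definition noetherian_ring : Prop := noetherian_module R^o.

Lemma ideal_mulr (I : ideal) (a b : R) : b \in I -> a * b \in I.
Proof. exact: (@rpredZ R R^o I a b). Qed.

Lemma maximal_prime (m : ideal) : maximal_ideal m -> prime_ideal m.
Proof.
case=> m1 mmax; split=> // a b abm.
have [am|/negP am] := boolP (a \in m); first by left.
right; pose J : {pred R^o} := fun x => `[< exists r : R, x - r * a \in m >].
have Jsub : submod_closed J.
  split; first by apply/asboolP; exists 0; rewrite mul0r subr0 rpred0.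
  move=> c x y /asboolP[r xr] /asboolP[s ys]; apply/asboolP.
  exists (c * r + s).
  have e (x' y' : R) : c * x' + y' - (c * r + s) * a =
    c * (x' - r * a) + (y' - s * a) by ring.
  by rewrite (e x y); apply: rpredD => //; apply: ideal_mulr.
have mJ : {subset m <= Submodule Jsub}.
  by move=> x xm; apply/asboolP; exists 0; rewrite mul0r subr0.
have aJ : a \in Submodule Jsub.
  by apply/asboolP; exists 1; rewrite mul1r subrr rpred0.
have [|J1] := boolP (1 \in Submodule Jsub); last first.
  by case: am; apply: mmax aJ.
move=> /asboolP[r h1].
have e : b = b * (1 - r * a) + r * (a * b) by ring.
by rewrite e; apply: rpredD; apply: ideal_mulr.
Qed.

End Ideals.

Section Minimax.
Variables (R : comPzRingType) (M : lmodType R).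

Definition minimax : Prop :=
  exists N : submodule M, fg_submodule N /\ artinian_module (quotmod N).

Definition associated_primes : set (ideal R) :=
  [set p | prime_ideal p /\
           exists x : M, forall a : R, a \in p <-> a *: x = 0].

End Minimax.

Definition weakly_laskerian (R : comPzRingType) (M : lmodType R) : Prop :=
  forall N : submodule M, finite_set (associated_primes (quotmod N)).

Section Denominators.
Variables (R : comPzRingType) (S : mulrClosed R).

Definition denom : Type := {s : R | s \in S}.
HB.instance Definition _ := Choice.on denom.

Definition denom1 : denom := exist _ 1 (rpred1 S).
Definition denomM (s t : denom) : denom :=
  exist _ (sval s * sval t) (rpredM (svalP s) (svalP t)).

End Denominators.

Section LocalizedGroup.
Variables (R : comPzRingType) (S : mulrClosed R) (M : lmodType R).
Implicit Types (x y : M) (s t : denom S).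

Definition loc_rel (p q : M * denom S) : bool :=
  `[< exists2 u : R, u \in S &
      (u * sval q.2) *: p.1 = (u * sval p.2) *: q.1 >].

Lemma loc_rel_equiv : equiv_class_of loc_rel.
Proof.
split=> [p|p q|q p r]; first by apply/asboolP; exists 1; rewrite ?rpred1.
  by apply/asboolP/asboolP => -[u uS e]; exists u.
move=> /asboolP[u uS e] /asboolP[v vS f]; apply/asboolP.
exists (u * v * sval q.2); first by rewrite !rpredM // (svalP q.2).
have -> : u * v * sval q.2 * sval r.2 = (v * sval r.2) * (u * sval q.2) by ring.
rewrite -scalerA e scalerA.
have -> : v * sval r.2 * (u * sval p.2) = (u * sval p.2) * (v * sval r.2) by ring.
by rewrite -scalerA f scalerA; congr (_ *: _); ring.
Qed.

Canonical loc_rel_equivRel := EquivRelPack loc_rel_equiv.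
Canonical loc_rel_encModRel := defaultEncModRel loc_rel.

Definition locmod : Type := {eq_quot loc_rel}.
HB.instance Definition _ := Choice.on locmod.
HB.instance Definition _ := EqQuotient.copy locmod {eq_quot loc_rel}.

Definition locfrac (x : M) (s : denom S) : locmod := \pi_locmod (x, s).

Lemma locfracP x s y t : locfrac x s = locfrac y t <->
  exists2 u : R, u \in S & (u * sval t) *: x = (u * sval s) *: y.
Proof. by split=> [/eqmodP/asboolP|h]; last by apply/eqmodP/asboolP. Qed.

Lemma locfrac_repr (z : locmod) : z = locfrac (repr z).1 (repr z).2.
Proof. by rewrite /locfrac -surjective_pairing reprK. Qed.

Lemma locfrac_surj (z : locmod) : exists x s, z = locfrac x s.
Proof. by exists (repr z).1, (repr z).2; apply: locfrac_repr. Qed.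

Lemma repr_locfrac x s : exists2 u : R, u \in S &
  (u * sval s) *: (repr (locfrac x s)).1 = (u * sval (repr (locfrac x s)).2) *: x.
Proof. exact/locfracP/esym/locfrac_repr. Qed.

Definition loc_zero : locmod := locfrac 0 (denom1 S).
Definition loc_opp (z : locmod) : locmod := locfrac (- (repr z).1) (repr z).2.
Definition loc_add (z w : locmod) : locmod :=
  locfrac (sval (repr w).2 *: (repr z).1 + sval (repr z).2 *: (repr w).1)
       (denomM (repr z).2 (repr w).2).

Lemma loc_oppE x s : loc_opp (locfrac x s) = locfrac (- x) s.
Proof.
have [u uS e] := repr_locfrac x s.
by apply/locfracP; exists u => //; rewrite !scalerN e.
Qed.

Lemma loc_addE x s y t : loc_add (locfrac x s) (locfrac y t) =
  locfrac (sval t *: x + sval s *: y) (denomM s t).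
Proof.
have [u uS e] := repr_locfrac x s; have [v vS f] := repr_locfrac y t.
apply/locfracP; exists (u * v); rewrite ?rpredM //=.
move: (repr (locfrac x s)) (repr (locfrac y t)) e f => [x' s'] [y' t'] /= e f.
rewrite !scalerDr !scalerA; congr (_ + _).
  have -> : u * v * (sval s * sval t) * sval t' =
            (v * sval t * sval t') * (u * sval s) by ring.
  by rewrite -scalerA e scalerA; congr (_ *: _); ring.
have -> : u * v * (sval s * sval t) * sval s' =
          (u * sval s * sval s') * (v * sval t) by ring.
by rewrite -scalerA f scalerA; congr (_ *: _); ring.
Qed.

Lemma loc_addA : associative loc_add.
Proof.
move=> a b c; have [x [s ->]] := locfrac_surj a; have [y [t ->]] := locfrac_surj b.
have [z [r ->]] := locfrac_surj c; rewrite !loc_addE.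
apply/locfracP; exists 1; rewrite ?rpred1 //= !scalerDr !scalerA addrA.
by congr (_ *: _ + _ *: _ + _ *: _); ring.
Qed.

Lemma loc_addC : commutative loc_add.
Proof.
move=> a b; have [x [s ->]] := locfrac_surj a; have [y [t ->]] := locfrac_surj b.
rewrite !loc_addE addrC; apply/locfracP; exists 1; rewrite ?rpred1 //=.
by congr (_ *: _); ring.
Qed.

Lemma loc_add0 : left_id loc_zero loc_add.
Proof.
move=> a; have [x [s ->]] := locfrac_surj a; rewrite loc_addE.
apply/locfracP; exists 1; rewrite ?rpred1 //= scaler0 add0r !scalerA.
by congr (_ *: _); ring.
Qed.

Lemma loc_addN : left_inverse loc_zero loc_opp loc_add.
Proof.
move=> a; have [x [s ->]] := locfrac_surj a; rewrite loc_oppE loc_addE.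
apply/locfracP; exists 1; rewrite ?rpred1 //=.
by rewrite scalerN addNr !scaler0.
Qed.

HB.instance Definition _ :=
  GRing.isZmodule.Build locmod loc_addA loc_addC loc_add0 loc_addN.

Lemma locfracD x s y t :
  locfrac x s + locfrac y t = locfrac (sval t *: x + sval s *: y) (denomM s t).
Proof. exact: loc_addE. Qed.

End LocalizedGroup.

Section LocalizedRing.
Variables (R : comPzRingType) (S : mulrClosed R).

Definition locring : Type := locmod S R^o.
HB.instance Definition _ := GRing.Zmodule.on locring.

Section Scale.
Variable M : lmodType R.

Definition loc_scale (a : locring) (z : locmod S M) : locmod S M :=
  locfrac (((repr a).1 : R) *: (repr z).1) (denomM (repr a).2 (repr z).2).

Lemma loc_scaleE (a : R) s (x : M) t :
  loc_scale (locfrac (a : R^o) s) (locfrac x t) = locfrac (a *: x) (denomM s t).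
Proof.
rewrite /loc_scale; have [u uS] := repr_locfrac (a : R^o) s.
have [v vS f] := repr_locfrac x t.
move: (repr (locfrac (a : R^o) s)) (repr (locfrac x t)) f => [a' s'] [x' t'] /= f.
rewrite -[(u * _) *: a']/((u * sval s) * a').
rewrite -[(u * _) *: (a : R^o)]/((u * sval s') * a) => e.
apply/locfracP; exists (u * v); rewrite ?rpredM //= !scalerA.
have -> : u * v * (sval s * sval t) * a' =
          (u * sval s * a') * (v * sval t) by ring.
by rewrite -scalerA f e scalerA; congr (_ *: _); ring.
Qed.

End Scale.

Definition loc_one : locring := locfrac (1 : R^o) (denom1 S).
Definition loc_mul (a b : locring) : locring := loc_scale a b.

Lemma loc_mulE (a b : R) s t :
  loc_mul (locfrac (a : R^o) s) (locfrac (b : R^o) t) =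
  locfrac (a * b : R^o) (denomM s t).
Proof. exact: loc_scaleE. Qed.

Lemma loc_mulA : associative loc_mul.
Proof.
move=> a b c; have [x [s ->]] := locfrac_surj a; have [y [t ->]] := locfrac_surj b.
have [z [r ->]] := locfrac_surj c.
rewrite (loc_mulE y z) (loc_mulE x (y * z)) (loc_mulE x y) (loc_mulE (x * y) z).
apply/locfracP; exists 1; rewrite ?rpred1 //= mulrA.
by congr (_ *: _); ring.
Qed.

Lemma loc_mulC : commutative loc_mul.
Proof.
move=> a b; have [x [s ->]] := locfrac_surj a; have [y [t ->]] := locfrac_surj b.
rewrite !loc_mulE; apply/locfracP; exists 1; rewrite ?rpred1 //= [x * y]mulrC.
by congr (_ *: _); ring.
Qed.

Lemma loc_mul1 : left_id loc_one loc_mul.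
Proof.
move=> a; have [x [s ->]] := locfrac_surj a; rewrite loc_mulE mul1r.
by apply/locfracP; exists 1; rewrite ?rpred1 //=; congr (_ *: _); ring.
Qed.

Lemma loc_mulD : left_distributive loc_mul +%R.
Proof.
move=> a b c; have [x [s ->]] := locfrac_surj a; have [y [t ->]] := locfrac_surj b.
have [z [r ->]] := locfrac_surj c; rewrite [locfrac x s + _]locfracD !loc_mulE [RHS]locfracD.
apply/locfracP; exists 1; rewrite ?rpred1 //=.
rewrite -![_ *: (_ : R^o)]/(_ * _ : R).
ring.
Qed.

HB.instance Definition _ := GRing.Zmodule_isComPzRing.Build locring
  loc_mulA loc_mulC loc_mul1 loc_mulD.

Lemma locfracM (a b : R) s t :
  (locfrac (a : R^o) s : locring) * locfrac (b : R^o) t = locfrac (a * b : R^o) (denomM s t).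
Proof. exact: loc_mulE. Qed.

End LocalizedRing.

Section LocalizedModule.
Variables (R : comPzRingType) (S : mulrClosed R) (M : lmodType R).
Implicit Types (a b : locring S) (z w : locmod S M).

Lemma loc_scaleA a b z : loc_scale a (loc_scale b z) = loc_scale (a * b) z.
Proof.
have [x [s ->]] := locfrac_surj a; have [y [t ->]] := locfrac_surj b.
have [v [r ->]] := locfrac_surj z.
rewrite (@locfracM R S x y) (@loc_scaleE R S M y) (@loc_scaleE R S M x).
rewrite (@loc_scaleE R S M (x * y)).
apply/locfracP; exists 1; rewrite ?rpred1 //= !scalerA.
by congr (_ *: _); ring.
Qed.

Lemma loc_scale1 : left_id 1 (@loc_scale R S M).
Proof.
move=> z; have [v [r ->]] := locfrac_surj z; rewrite loc_scaleE scale1r.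
by apply/locfracP; exists 1; rewrite ?rpred1 //=; congr (_ *: _); ring.
Qed.

Lemma loc_scaleDr : right_distributive (@loc_scale R S M) +%R.
Proof.
move=> a z w; have [x [s ->]] := locfrac_surj a; have [y [t ->]] := locfrac_surj z.
have [v [r ->]] := locfrac_surj w; rewrite locfracD !loc_scaleE locfracD.
apply/locfracP; exists 1; rewrite ?rpred1 //= !scalerDr !scalerA.
by congr (_ *: _ + _ *: _); ring.
Qed.

Lemma loc_scaleDl z : {morph (@loc_scale R S M)^~ z : a b / a + b}.
Proof.
move=> a b; have [x [s ->]] := locfrac_surj a; have [y [t ->]] := locfrac_surj b.
have [v [r ->]] := locfrac_surj z; rewrite [locfrac x s + _]locfracD !loc_scaleE locfracD.
apply/locfracP; exists 1; rewrite ?rpred1 //=.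
rewrite -![_ *: (_ : R^o)]/(_ * _ : R) !scalerA -scalerDl !scalerA.
by congr (_ *: _); ring.
Qed.

HB.instance Definition _ := GRing.Zmodule_isLmodule.Build (locring S) (locmod S M)
  loc_scaleA loc_scale1 loc_scaleDr loc_scaleDl.

End LocalizedModule.

Section LocalizationAtPrime.
Variables (R : comPzRingType) (p : ideal R) (hp : prime_ideal p).

Definition prime_compl (_ : prime_ideal p) : {pred R} := fun a => a \notin p.

Lemma prime_compl_mulr_closed : mulr_closed (prime_compl hp).
Proof.
split; first by case: hp.
move=> a b /negP ap /negP bp; apply/negP => abp.
by case: hp => _ /(_ a b abp) [].
Qed.

HB.instance Definition _ :=
  GRing.isMulClosed.Build R (prime_compl hp) prime_compl_mulr_closed.

Definition locring_at : comPzRingType := locring (prime_compl hp).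
Definition locmod_at (M : lmodType R) : lmodType locring_at :=
  locmod (prime_compl hp) M.

End LocalizationAtPrime.

(* Main.v *)
Require Import Defs.
From HB Require Import structures.
From mathcomp Require Import all_boot all_algebra ring.
From mathcomp Require Import boolp classical_sets cardinality.

(** Everything is expressed through submodules of [M] itself: a quotient [M/N]
    is artinian when descending chains of submodules above [N] stabilise
    ([artinian_quotP]), and the associated primes of [M/K] are the primes of the
    form [(K : x)] ([ass_quotP]).

    From minimax to the local condition: submodules of [S^-1 M] are determined by
    their contractions to [M], so chains stabilise because their contractions do
    ([minimax_loc]).  From minimax to weakly laskerian: a prime [(K : x)] is
    either [(K : y)] with [y] in [N], or it equals [(N + K : x)]
    ([ass_in_split]).  This splits the associated primes of [M/K] along a finitely
    generated [N] with [M/N] artinian.  Applied again one generator at a time, it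
    reduces the first part to cyclic modules.  In both extreme cases an infinite
    set of associated primes would contain a sequence [p_0, p_1, ...] with [p_n]
    not inside [p_i] for [n < i].  The submodules of elements vanishing at a tail
    (cyclic case) or at a head (artinian case) of that sequence would then form
    a strict chain ([ass_cyclic_finite], [dcc_ass_finite]).

    Conversely, a weakly laskerian [M] has a finitely generated submodule [A] such
    that [M/A] vanishes at all but finitely many maximal ideals
    ([weakly_laskerian_finite_support]).  Otherwise one could choose new maximal
    ideals [m_1, m_2, ...] forever, together with submodules [K_1 <= K_2 <= ...]
    such that [m_1, ..., m_i] are associated primes of [M/K_i] and remain so in
    every later quotient ([stage_extend]).  The quotient by the union of the [K_i]
    would have infinitely many associated primes.

    Enlarging [A] by finitely many finitely generated submodules provided by the
    minimax localizations at the exceptional maximal ideals gives a finitely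
    generated [B] for which chains above [B] stabilise locally at each maximal
    ideal, and uniformly so.  Since membership in a submodule is a local property,
    they stabilise ([dcc_of_local]), that is, [M/B] is artinian. *)

Set Implicit Arguments.
Unset Strict Implicit.
Unset Printing Implicit Defensive.

Import GRing.Theory.
Local Open Scope ring_scope.

(** * Submodules *)

(** Classical equality on submodules makes finite lists of pairwise distinct
    ideals available. *)
HB.instance Definition _ (R : comPzRingType) (M : lmodType R) :=
  gen_eqMixin (submodule M).

Section Subm.
Variables (R : comPzRingType) (M : lmodType R).
Implicit Types (N K A : submodule M).

Lemma submodule_ext N K : N =i K -> N = K.
Proof.
case: N K => f hf [g hg] e; have {}e : f = g by apply/funext => x; exact: e.
by case: _ / e hg => hg; rewrite (Prop_irrelevance hf hg).
Qed.

Section Comprehension.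
Variable P : M -> Prop.
Hypotheses (P0 : P 0) (PD : forall a x y, P x -> P y -> P (a *: x + y)).

Lemma submod_of_closed : submod_closed (fun x => `[< P x >]).
Proof. by split=> [|a x y /asboolP Px /asboolP Py]; apply/asboolP; auto. Qed.

Definition submod_of : submodule M := Submodule submod_of_closed.

Lemma submod_ofP x : x \in submod_of <-> P x.
Proof. by split=> [/asboolP|h]; last exact/asboolP. Qed.
End Comprehension.

Lemma rpredZD N a x y : x \in N -> y \in N -> a *: x + y \in N.
Proof. by move=> xN yN; rewrite rpredD ?rpredZ. Qed.

Fact sum_submod0 N K : exists2 y, y \in N & 0 - y \in K.
Proof. by exists 0; rewrite ?subr0 rpred0. Qed.

Fact sum_submod_closed N K a x x' : (exists2 y, y \in N & x - y \in K) ->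
  (exists2 y, y \in N & x' - y \in K) ->
  exists2 y, y \in N & a *: x + x' - y \in K.
Proof.
move=> [y yN yK] [y' y'N y'K]; exists (a *: y + y'); first exact: rpredZD.
by rewrite opprD addrACA -scalerBr rpredZD.
Qed.

Definition sum_submod N K : submodule M :=
  submod_of (sum_submod0 N K) (@sum_submod_closed N K).

Lemma sum_submodP N K x : x \in sum_submod N K <-> exists2 y, y \in N & x - y \in K.
Proof. exact: submod_ofP. Qed.

Lemma sub_sum_submodl N K : {subset N <= sum_submod N K}.
Proof. by move=> x xN; apply/sum_submodP; exists x; rewrite // subrr rpred0. Qed.

Lemma sub_sum_submodr N K : {subset K <= sum_submod N K}.
Proof. by move=> x xK; apply/sum_submodP; exists 0; rewrite ?subr0 ?rpred0. Qed.

Fact span_submod0 n (g : 'I_n -> M) : exists c : 'I_n -> R, 0 = \sum_i c i *: g i.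
Proof. by exists (fun=> 0); rewrite big1 // => i _; rewrite scale0r. Qed.

Fact span_submod_closed n (g : 'I_n -> M) (a : R) x y :
  (exists c : 'I_n -> R, x = \sum_i c i *: g i) ->
  (exists c : 'I_n -> R, y = \sum_i c i *: g i) ->
  exists c : 'I_n -> R, a *: x + y = \sum_i c i *: g i.
Proof.
move=> [c ->] [d ->]; exists (fun i => a * c i + d i).
by rewrite scaler_sumr -big_split; apply: eq_bigr => i _; rewrite scalerDl scalerA.
Qed.

Definition span_submod n (g : 'I_n -> M) : submodule M :=
  submod_of (span_submod0 g) (@span_submod_closed n g).

Lemma span_submodP n (g : 'I_n -> M) x :
  x \in span_submod g <-> exists c : 'I_n -> R, x = \sum_i c i *: g i.
Proof. exact: submod_ofP. Qed.

Lemma mem_span_submod n (g : 'I_n -> M) i : g i \in span_submod g.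
Proof.
apply/span_submodP; exists (fun j => (j == i)%:R); rewrite (bigD1 i) //= eqxx scale1r.
by rewrite big1 ?addr0 // => j /negPf ->; rewrite scale0r.
Qed.

Lemma span_submod_sub n (g : 'I_n -> M) N :
  (forall i, g i \in N) -> {subset span_submod g <= N}.
Proof. by move=> h x /span_submodP[c ->]; apply: rpred_sum => i _; exact: rpredZ. Qed.

Lemma fg_span_submod n (g : 'I_n -> M) : fg_submodule (span_submod g).
Proof. by exists n, g => x; exact: span_submodP. Qed.

Lemma fg_eq_span_submod N :
  fg_submodule N -> exists n (g : 'I_n -> M), N = span_submod g.
Proof.
move=> [n [g h]]; exists n, g; apply: submodule_ext => x.
by apply/idP/idP => [/h/span_submodP|/span_submodP/h].
Qed.

Lemma fg_sum_submod N K :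
  fg_submodule N -> fg_submodule K -> fg_submodule (sum_submod N K).
Proof.
move=> [n [g gN]] [k [h hK]].
pose f (i : 'I_(n + k)) := match split i with inl j => g j | inr j => h j end.
have fl j : f (lshift k j) = g j by rewrite /f (unsplitK (inl _)).
have fr j : f (rshift n j) = h j by rewrite /f (unsplitK (inr _)).
exists (n + k)%N, f => x; split=> [/sum_submodP[y /gN[c ec] /hK[d ed]]|[c ->]].
  exists (fun i => match split i with inl j => c j | inr j => d j end).
  rewrite big_split_ord /= -[LHS](subrKC y) ed ec; congr (_ + _).
    by apply: eq_bigr => i _; rewrite fl (unsplitK (inl _)).
  by apply: eq_bigr => i _; rewrite fr (unsplitK (inr _)).
apply: rpred_sum => i _; apply: rpredZ; rewrite /f.
case: (split i) => j; [apply/sub_sum_submodl/gN | apply/sub_sum_submodr/hK].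
  by apply/span_submodP/mem_span_submod.
by apply/span_submodP/mem_span_submod.
Qed.

Definition cyclic_submod x : submodule M := span_submod (fun _ : 'I_1 => x).

Lemma cyclic_submodP x y : y \in cyclic_submod x <-> exists a, y = a *: x.
Proof.
split=> [/span_submodP[c ->]|[a ->]]; first by exists (c ord0); rewrite big_ord1.
by apply/span_submodP; exists (fun=> a); rewrite big_ord1.
Qed.

Fact colon0 K x : (0 : R) *: x \in K.
Proof. by rewrite scale0r rpred0. Qed.
Fact colon_closed K x (a b c : R) : b *: x \in K -> c *: x \in K ->
  (a * b + c) *: x \in K.
Proof. by move=> hb hc; rewrite scalerDl -scalerA; apply: rpredZD. Qed.

Lemma chain_le (X : nat -> submodule M) : (forall k, {subset X k.+1 <= X k}) ->
  forall n k, (n <= k)%N -> {subset X k <= X n}.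
Proof.
move=> h n k; elim: k => [|k IH]; first by rewrite leqn0 => /eqP->.
by rewrite leq_eqVlt => /predU1P[->//|/IH s] x /h/s.
Qed.

End Subm.

Section Colon.
Variables (R : comPzRingType) (M : lmodType R).
Definition colon (K : submodule M) x : ideal R :=
  @submod_of R R^o (fun a : R => a *: x \in K) (colon0 K x) (@colon_closed R M K x).

Lemma colonP (K : submodule M) x (a : R) : a \in colon K x <-> a *: x \in K.
Proof. exact: (@submod_ofP R R^o). Qed.
End Colon.

(** * Artinian quotients and associated primes of quotients *)

Section Dcc.
Variables (R : comPzRingType) (M : lmodType R).
Implicit Types (N K : submodule M).

Definition dcc_above N := forall X : nat -> submodule M,
  (forall k, {subset N <= X k}) -> (forall k, {subset X k.+1 <= X k}) ->
  exists n, forall k, (n <= k)%N -> {subset X n <= X k}.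

(** The chain condition for the localization of [M/N] at [S], written without
    fractions: a term of the chain has the same localization as a later one when
    each of its elements is multiplied into the later one by some [c] in [S]. *)
Definition local_dcc N (S : R -> Prop) := forall X : nat -> submodule M,
  (forall k, {subset N <= X k}) -> (forall k, {subset X k.+1 <= X k}) ->
  exists n, forall k, (n <= k)%N -> forall x, x \in X n ->
    exists2 c : R, S c & c *: x \in X k.

Lemma quot0P N x : quotmod_pi N x = 0 <-> x \in N.
Proof.
have <- : quotmod_pi N 0 = 0.
  by apply: (addIr (quotmod_pi N 0)); rewrite -quotmod_piD !add0r.
by rewrite quotmod_piP subr0.
Qed.

Lemma quotZ N (a : R) x : a *: quotmod_pi N x = quotmod_pi N (a *: x).
Proof. exact: quotmod_piZ. Qed.

Lemma artinian_quotP N : artinian_module (quotmod N) <-> dcc_above N.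
Proof.
split=> [art X NX Xd|dcc Y Yd].
  pose P k (u : quotmod N) := exists2 x, x \in X k & u = quotmod_pi N x.
  have P0 k : P k 0 by exists 0; [exact: rpred0 | exact/esym/quot0P/rpred0].
  have PD k a u v : P k u -> P k v -> P k (a *: u + v).
    move=> [x xX ->] [y yX ->]; exists (a *: x + y); first exact: rpredZD.
    by rewrite quotZ quotmod_piD.
  pose Y k := submod_of (P0 k) (PD k).
  have YX k x : quotmod_pi N x \in Y k <-> x \in X k.
    split=> [/submod_ofP[y yX /quotmod_piP xy]|xX]; last by apply/submod_ofP; exists x.
    by rewrite -(subrK y x) rpredD // (NX k).
  have [|n hn] := art Y.
    by move=> k u; have [x ->] := quotmod_pi_surj u => /YX xX; apply/YX/Xd.
  by exists n => k nk x xX; apply/YX; rewrite (hn k nk); apply/YX.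
pose P k x := quotmod_pi N x \in Y k.
have P0 k : P k 0 by rewrite /P (quot0P N 0).2 ?rpred0.
have PD k a x y : P k x -> P k y -> P k (a *: x + y).
  by move=> ? ?; rewrite /P quotmod_piD -quotZ rpredZD.
pose X k := submod_of (P0 k) (PD k).
have XE k x : x \in X k <-> P k x by exact: submod_ofP.
have [||n hn] := dcc X.
- move=> k x xN; apply/XE; rewrite /P (quot0P N x).2 //; exact: rpred0.
- by move=> k x /XE xY; apply/XE/Yd.
exists n => k nk u; apply/idP/idP; first exact: (chain_le Yd).
have [x ->] := quotmod_pi_surj u => xY; apply/XE/hn => //; exact/XE.
Qed.

Lemma minimaxP : minimax M <-> exists N : submodule M, fg_submodule N /\ dcc_above N.
Proof. by split=> -[N [fN /artinian_quotP aN]]; exists N. Qed.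

Lemma ass_quotP N (p : ideal R) : associated_primes (quotmod N) p <->
  prime_ideal p /\ exists x : M, forall a : R, a \in p <-> a *: x \in N.
Proof.
split=> [[pp [u]]|[pp [x h]]].
  have [x ->] := quotmod_pi_surj u => h; split=> //; exists x => a.
  by rewrite h quotZ quot0P.
by split=> //; exists (quotmod_pi N x) => a; rewrite h quotZ quot0P.
Qed.

End Dcc.

(** * Noetherian rings *)

Section Noeth.
Variables (R : comPzRingType) (hR : noetherian_ring R).

Lemma noetherian_max (P : ideal R -> Prop) I0 : P I0 ->
  exists2 I, P I & forall J, P J -> {subset I <= J} -> {subset J <= I}.
Proof.
move=> P0; apply: contrapT => no.
have next (I : {I | P I}) : exists J : {I | P I},
    {subset sval I <= sval J} /\ ~ {subset sval J <= sval I}.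
  case: I => I PI /=; apply: contrapT => nJ; apply: no; exists I => // J PJ IJ.
  by apply: contrapT => JI; apply: nJ; exists (exist _ J PJ).
have [f hf] := choice next.
pose N k := sval (iter k f (exist _ I0 P0)).
have [n hn] := hR (fun k => (hf (iter k f (exist _ I0 P0))).1).
by case: (hf (iter n f (exist _ I0 P0))) => _; apply=> x; rewrite (hn n.+1).
Qed.

Lemma proper_sub_maximal (I : ideal R) : 1 \notin I ->
  exists2 m : ideal R, maximal_ideal m & {subset I <= m}.
Proof.
move=> I1.
have [m [Im m1] hm] :=
  @noetherian_max (fun J => {subset I <= J} /\ 1 \notin J) I (conj (fun _ h => h) I1).
by exists m => //; split=> // J mJ J1; apply: hm => //; split=> // x /Im/mJ.
Qed.

(** Choose [p_n] maximal in what is left of [S], then discard the ideals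
    containing [p_n]: by maximality only [p_n] itself is lost, so infinitely many
    remain. *)
Lemma infinite_ideal_seq (S : set (ideal R)) : infinite_set S ->
  exists p : nat -> ideal R, (forall i, S (p i)) /\
    forall n i, (n < i)%N -> ~ {subset p n <= p i}.
Proof.
move=> Sinf.
have next (T : {T : set (ideal R) | infinite_set T}) : exists pT' :
    ideal R * {T : set (ideal R) | infinite_set T},
    sval T pT'.1 /\
    forall q, sval pT'.2 q -> sval T q /\ ~ {subset pT'.1 <= q}.
  case: T => T Tinf /=; have [I0 TI0] := infinite_setN0 Tinf.
  have [p Tp pmax] := noetherian_max TI0.
  suff inf : infinite_set [set q | T q /\ ~ {subset p <= q}].
    by exists (p, exist (fun T => infinite_set T) _ inf).
  move=> fin; apply: Tinf; apply: sub_finite_set (_ : finite_set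
    ([set p] `|` [set q | T q /\ ~ {subset p <= q}])%classic).
    move=> q Tq /=; have [pq|] := pselect {subset p <= q}; last by right.
    by left; apply: submodule_ext => x; apply/idP/idP; [apply: pmax|apply: pq].
  by rewrite finite_setU.
have [f hf] := choice next.
pose T k := iter k (fun T => (f T).2) (exist (fun T => infinite_set T) S Sinf).
have TS k q : sval (T k) q -> S q.
  by elim: k => //= k IH /((hf (T k)).2 q)[/IH].
exists (fun k => (f (T k)).1); split=> [i|n i]; first exact/TS/(hf (T i)).1.
have pT := (hf (T i)).1; move: ((f (T i)).1) pT => q.
elim: i => //= i IH /((hf (T i)).2 q)[Tq nq].
by rewrite ltnS leq_eqVlt => /predU1P[->//|]; exact: IH.
Qed.

End Noeth.

Lemma not_subset_ex (R : comPzRingType) (p q : ideal R) :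
  ~ {subset p <= q} -> exists2 a, a \in p & a \notin q.
Proof.
move=> npq; apply: contrapT => no; apply: npq => a ap.
by apply/negPn/negP => aq; apply: no; exists a.
Qed.

(** * Elements vanishing at a set of primes *)

Section Locally.
Variables (R : comPzRingType) (M : lmodType R) (K : submodule M).
Variables (Q : ideal R -> Prop) (Qprime : forall p, Q p -> prime_ideal p).

(** The image of [x] in the localization of [M/K] at each prime of [Q] is zero. *)
Definition vanishes_at x := forall p, Q p -> exists2 c : R, c \notin p & c *: x \in K.

Fact vanishes_at0 : vanishes_at 0.
Proof. by move=> p /Qprime[p1 _]; exists 1; rewrite // scaler0 rpred0. Qed.

Fact vanishes_at_closed (a : R) x y :
  vanishes_at x -> vanishes_at y -> vanishes_at (a *: x + y).
Proof.
move=> hx hy p Qp; have [c cp cx] := hx p Qp; have [d dp dy] := hy p Qp.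
exists (c * d).
  by apply/negP => /(Qprime Qp).2[]; apply/negP.
have -> : (c * d) *: (a *: x + y) = (d * a) *: (c *: x) + c *: (d *: y).
  by rewrite scalerDr !scalerA; congr (_ *: _ + _); ring.
by rewrite rpredD // rpredZ.
Qed.

Definition vanishing : submodule M := submod_of vanishes_at0 vanishes_at_closed.

Lemma vanishingP x : x \in vanishing <->
  forall p, Q p -> exists2 c : R, c \notin p & c *: x \in K.
Proof. exact: submod_ofP. Qed.
End Locally.

(** The ideal [(X : x)] lies in no maximal ideal, hence is the unit ideal. *)
Lemma local_global (R : comPzRingType) (hR : noetherian_ring R) (M : lmodType R)
    (X : submodule M) x :
  (forall m : ideal R, maximal_ideal m -> exists2 c : R, c \notin m & c *: x \in X) ->
  x \in X.
Proof.
move=> h; rewrite -[x]scale1r; have [/colonP//|I1] := boolP (1 \in colon X x).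
have [m mm Im] := proper_sub_maximal hR I1.
by have [c /negP cm cx] := h m mm; case: cm; apply/Im/colonP.
Qed.

(** * Minimax modules are weakly laskerian *)

Section Ass.
Variables (R : comPzRingType) (M : lmodType R).
Implicit Types (A : {pred M}) (N K : submodule M) (p : ideal R).

(** For a submodule [A], the associated primes of the image of [A] in [M/K]. *)
Definition ass_in K A : set (ideal R) := fun p =>
  prime_ideal p /\ exists2 x, x \in A & forall a : R, a \in p <-> a *: x \in K.

(** If some [r] outside [p] sends [x] into [N + K], say [r x = y + k], then
    [(K : y) = (K : r x) = p] because [p] is prime.  Otherwise [(N + K : x)] is
    not larger than [p]. *)
Lemma ass_in_split K N A p :
  ass_in K A p -> ass_in K N p \/ ass_in (sum_submod N K) A p.
Proof.
move=> [pp [x xA hx]].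
have [[r rp /sum_submodP[y yN ry]]|no] :=
  pselect (exists2 r, r \notin p & r *: x \in sum_submod N K); [left|right].
  split=> //; exists y => // a.
  have -> : a *: y \in K <-> a *: (r *: x) \in K.
    have e : a *: (r *: x) = a *: y + a *: (r *: x - y) by rewrite -scalerDr subrKC.
    by rewrite e rpredDr //; apply: rpredZ.
  rewrite scalerA -hx; split=> [ap|/pp.2[//|]]; last by rewrite (negPf rp).
  by rewrite mulrC; apply: ideal_mulr.
split=> //; exists x => // a; split=> [/hx|h]; first exact: sub_sum_submodr.
by apply/negPn/negP => ap; apply: no; exists a.
Qed.

Hypothesis hR : noetherian_ring R.

(** For a sequence [p_n = (K : x_n)] with [p_n] not inside [p_i] for [n < i], the
    elements of the cyclic module vanishing at [p_n, p_(n+1), ...] increase with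
    [n], and strictly: [x_n] vanishes at all [p_i] with [i > n] but not at [p_n].
    The chain is read off in the ring, through the multiples of the generator. *)
Lemma ass_cyclic_finite K g : finite_set (ass_in K (cyclic_submod g)).
Proof.
apply: contrapT => /(infinite_ideal_seq hR)[p [pA pn]].
pose Q n q := exists2 i, (n <= i)%N & q = p i.
have Qp n q : Q n q -> prime_ideal q by move=> [i _ ->]; exact: (pA i).1.
have [n hn] : exists n, forall k, (n <= k)%N ->
    colon (vanishing K (@Qp k)) g =i colon (vanishing K (@Qp n)) g.
  apply: hR => n a /colonP/vanishingP h; apply/colonP/vanishingP => q [i ni ->].
  by apply: h; exists i => //; exact: ltnW.
have [_ [_ /cyclic_submodP[r ->] hr]] := pA n.
have : r \in colon (vanishing K (@Qp n.+1)) g.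
  apply/colonP/vanishingP => _ [i ni ->].
  by have [c cn ci] := not_subset_ex (pn n i ni); exists c => //; apply/hr.
rewrite hn // => /colonP/vanishingP/(_ (p n)) []; first by exists n.
by move=> c /negP cn /hr.
Qed.

(** Induction on the number of generators, splitting off the last one. *)
Lemma ass_span_finite n (g : 'I_n -> M) K : finite_set (ass_in K (span_submod g)).
Proof.
elim: n g K => [|n IH] g K.
  apply: sub_finite_set (finite_set0 _) => p [[p1 _]] [x /span_submodP[c ->]].
  by rewrite big_ord0 => /(_ 1) h; move/negP: p1; apply; apply/h; rewrite scaler0 rpred0.
pose g' i := g (widen_ord (leqnSn n) i).
apply: sub_finite_set (_ : finite_set (ass_in K (span_submod g') `|`
  ass_in (sum_submod (span_submod g') K) (cyclic_submod (g ord_max)))%classic);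
  last first.
  by rewrite finite_setU; split; [exact: IH | exact: ass_cyclic_finite].
move=> p /(@ass_in_split _ (span_submod g'))[|[pp [x /span_submodP[c ->]]]].
  by left.
rewrite big_ord_recr => hx; right; split=> //.
exists (c ord_max *: g ord_max); first by apply/cyclic_submodP; exists (c ord_max).
move=> a; rewrite hx scalerDr rpredDl //; apply/rpredZ/sub_sum_submodl/span_submodP.
by exists (fun i => c (widen_ord (leqnSn n) i)).
Qed.

(** For [a] outside [p = (N : x)] the chain [N + R a^n x] stabilises, so
    [a^n (1 - r a)] kills [x] modulo [N] for some [n] and [r]; since [p] is prime
    [1 - r a] is in [p], and [a] is invertible modulo [p]. *)
Lemma dcc_ass_maximal N A p : dcc_above N -> ass_in N A p -> maximal_ideal p.
Proof.
move=> dcc [pp [x _ hx]]; split=> [|I pI I1]; first exact: pp.1.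
suff key (a : R) : a \in I -> a \in p by exact: key.
move=> aI; apply/negPn/negP => ap.
pose X n := sum_submod N (cyclic_submod (a ^+ n *: x)).
have [||n hn] := dcc X; first by move=> k; exact: sub_sum_submodl.
  move=> k y /sum_submodP[z zN /cyclic_submodP[r e]]; apply/sum_submodP; exists z => //.
  by apply/cyclic_submodP; exists (r * a); rewrite e !scalerA exprS mulrA.
have /hn : a ^+ n *: x \in X n.
  by apply/sub_sum_submodr/cyclic_submodP; exists 1; rewrite scale1r.
move=> /(_ _ (leqnSn n))/sum_submodP[z zN /cyclic_submodP[r e]].
have : (a ^+ n * (1 - r * a)) *: x \in N.
  have -> : a ^+ n * (1 - r * a) = a ^+ n - r * a ^+ n.+1 by rewrite exprS; ring.
  by rewrite scalerBl -(scalerA r) -e opprB addrCA subrr addr0.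
move/hx => /pp.2[anp|/pI h].
  have : forall k, a ^+ k \in p -> False.
    elim=> [|k IH]; first by rewrite expr0 => h; move: pp.1; rewrite h.
    by rewrite exprS => /pp.2[|//]; rewrite (negPf ap).
  by move=> h; case: (h n).
move/negP: I1; apply; have -> : 1 = (1 - r * a) + r * a :> R by rewrite subrK.
by apply: rpredD => //; apply: ideal_mulr.
Qed.

(** Dual to the cyclic case: the elements vanishing at [p_0, ..., p_(n-1)]
    decrease with [n], strictly since [x_n] vanishes at [p_i] for [i < n] but not
    at [p_n].  Here [p_n] must not lie inside [p_i] for [i < n], whereas the
    sequence gives this for [i > n]; as the primes are maximal, inclusion is
    symmetric. *)
Lemma dcc_ass_finite N A : dcc_above N -> finite_set (ass_in N A).
Proof.
move=> dcc; apply: contrapT => /(infinite_ideal_seq hR)[p [pA pn]].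
have pm i : maximal_ideal (p i) by exact: dcc_ass_maximal (pA i).
pose Q n q := exists2 i, (i < n)%N & q = p i.
have Qp n q : Q n q -> prime_ideal q by move=> [i _ ->]; exact: (pA i).1.
have [||n hn] := dcc (fun n => vanishing N (@Qp n)).
- move=> k x xN; apply/vanishingP => q /Qp[q1 _].
  by exists 1; rewrite // scale1r.
- move=> k x /vanishingP h; apply/vanishingP => q [i ik ->].
  by apply: h; exists i => //; exact: leqW.
have [_ [x _ hx]] := pA n.
have /hn : x \in vanishing N (@Qp n).
  apply/vanishingP => _ [i ni ->].
  have [c cn ci] : exists2 c, c \in p n & c \notin p i.
    apply: not_subset_ex => ni'; apply: (pn i n ni).
    by apply: (pm n).2 ni' _; exact: (pm i).1.
  by exists c => //; apply/hx.
move=> /(_ _ (leqnSn n))/vanishingP/(_ (p n)) []; first by exists n.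
by move=> c /negP cn /hx.
Qed.

Lemma dcc_aboveW N K : {subset N <= K} -> dcc_above N -> dcc_above K.
Proof. by move=> NK dcc X KX; apply: dcc => k x /NK/KX. Qed.

Lemma minimax_weakly_laskerian : minimax M -> weakly_laskerian M.
Proof.
move=> /minimaxP[N [fN dN]] K; have [n [g eN]] := fg_eq_span_submod fN.
apply: sub_finite_set (_ : finite_set (ass_in K N `|`
  ass_in (sum_submod N K) predT)%classic); last first.
  rewrite finite_setU {1}eN; split; first exact: ass_span_finite.
  exact: dcc_ass_finite (dcc_aboveW (@sub_sum_submodl _ _ N K) dN).
move=> p /ass_quotP[pp [x hx]]; apply: ass_in_split.
by split=> //; exists x.
Qed.

End Ass.

(** * Support of weakly laskerian modules *)

Section WL.
Variables (R : comPzRingType) (hR : noetherian_ring R) (M : lmodType R).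
Implicit Types (A K : submodule M) (s : seq (ideal R)) (m : ideal R).

Fact ideal_smul0 m (z : M) : exists2 r : R, r \in m & 0 = r *: z.
Proof. by exists 0; [exact: rpred0 | rewrite scale0r]. Qed.

Fact ideal_smul_closed m (z : M) (a : R) x y :
  (exists2 r : R, r \in m & x = r *: z) ->
  (exists2 r : R, r \in m & y = r *: z) ->
  exists2 r : R, r \in m & a *: x + y = r *: z.
Proof.
move=> [r rm ->] [t tm ->]; exists (a * r + t).
  by apply: rpredD => //; exact: ideal_mulr.
by rewrite scalerDl scalerA.
Qed.

Definition ideal_smul m z : submodule M :=
  submod_of (ideal_smul0 m z) (@ideal_smul_closed m z).

Lemma ideal_smulP m z x : x \in ideal_smul m z <-> exists2 r : R, r \in m & x = r *: z.
Proof. exact: submod_ofP. Qed.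

Lemma maximal_sub_eq m (I : ideal R) : maximal_ideal m -> {subset m <= I} ->
  1 \notin I -> I = m.
Proof.
move=> [_ mm] mI I1; apply: submodule_ext => a.
by apply/idP/idP; [apply: mm | apply: mI].
Qed.

Lemma maximal_neq_ex m m' : maximal_ideal m -> maximal_ideal m' -> m != m' ->
  exists2 b, b \in m & b \notin m'.
Proof.
move=> hm hm' /eqP ne; apply: not_subset_ex => mm'; apply: ne.
by apply/esym/maximal_sub_eq => //; exact: hm'.1.
Qed.

(** A finite approximation of a quotient with infinitely many associated primes:
    [A/K] carries the maximal ideals of [s] as associated primes, and it vanishes
    at every other maximal ideal because some [a] outside that ideal kills it.
    The last property leaves room for adding a further maximal ideal. *)
Record stage A K s : Prop := Stage {
  stage_fg : fg_submodule A;
  stage_sub : {subset K <= A};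
  stage_uniq : uniq s;
  stage_ass : forall m, m \in s -> ass_in K (mem A) m;
  stage_max : forall m, m \in s -> maximal_ideal m;
  stage_ann : forall m, maximal_ideal m -> m \notin s ->
    exists2 a : R, a \notin m & forall x, x \in A -> a *: x \in K }.

Lemma stage0 :
  stage (span_submod (fun i : 'I_0 => 0)) (span_submod (fun i : 'I_0 => 0)) [::].
Proof.
split=> //; first exact: fg_span_submod.
move=> m hm _; exists 1; first exact: hm.1.
by move=> x; rewrite scale1r.
Qed.

(** Enlarging [K] preserves the associated primes carried by [A] as long as the
    intersection with [A] does not grow. *)
Lemma ass_in_ext K K' A A' m : {subset A <= A'} -> {subset K <= K'} ->
  (forall x, x \in A -> x \in K' -> x \in K) ->
  ass_in K (mem A) m -> ass_in K' (mem A') m.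
Proof.
move=> AA' KK' AK [pm [x xA hx]]; split=> //; exists x; first exact: AA'.
by move=> a; rewrite hx; split=> [/KK'|/AK]; last by apply; exact: rpredZ.
Qed.

(** Let [y] be nonzero in [M/A] locally at [m], and let [a] outside [m] kill
    [A/K].  The ideals [(K : a^k y)] stabilise at some [n].  With [z = a^n y], if
    [r z] is in [A] then [r a^(n+1) y] is in [K], so [r z] is in [K]: modulo [K]
    the submodule [R z] meets [A] trivially.  Hence dividing by [m z] does not
    disturb [A/K], while [z] stays nonzero and is now killed exactly by [m]. *)
Lemma stage_extend A K s m y : stage A K s -> maximal_ideal m -> m \notin s ->
  (forall c : R, c \notin m -> c *: y \notin A) ->
  exists A' K', [/\ stage A' K' (m :: s), {subset A <= A'}, {subset K <= K'} &
    forall x, x \in A -> x \in K' -> x \in K].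
Proof.
move=> st mm ms hy; have [a am aA] := stage_ann st mm ms.
have pm := maximal_prime mm.
have [n hn] : exists n, forall k, (n <= k)%N ->
    colon K (a ^+ k *: y) =i colon K (a ^+ n *: y).
  apply: hR => k r /colonP h; apply/colonP.
  rewrite exprS -scalerA [_ *: (_ *: _)]scalerA mulrC -scalerA.
  exact: rpredZ.
have anm k : a ^+ k \notin m.
  elim: k => [|k IH]; first by rewrite expr0 pm.1.
  by rewrite exprS; apply/negP => /pm.2[]; apply/negP.
pose z := a ^+ n *: y.
have zA r : r *: z \in A -> r *: z \in K.
  move=> /aA h; apply/colonP; rewrite -/z -(hn n.+1) //; apply/colonP.
  by rewrite exprS -scalerA scalerA mulrC -scalerA.
have AK x : x \in A -> x \in sum_submod (ideal_smul m z) K -> x \in K.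
  move=> xA /sum_submodP[_ /ideal_smulP[r rm ->] h].
  rewrite -(subrK (r *: z) x) rpredD // zA //.
  have -> : r *: z = x - (x - r *: z) by rewrite subKr.
  by rewrite rpredB // (stage_sub st).
have KK' : {subset K <= sum_submod (ideal_smul m z) K} by exact: sub_sum_submodr.
have zK' b : b \in m -> b *: z \in sum_submod (ideal_smul m z) K.
  by move=> bm; apply/sub_sum_submodl/ideal_smulP; exists b.
have AA' : {subset A <= sum_submod A (cyclic_submod z)} by exact: sub_sum_submodl.
have zA' : z \in sum_submod A (cyclic_submod z).
  by apply/sub_sum_submodr/cyclic_submodP; exists 1; rewrite scale1r.
have zm : colon (sum_submod (ideal_smul m z) K) z = m.
  apply: maximal_sub_eq => // [b bm|]; first exact/colonP/zK'.
  apply/negP => /colonP; rewrite scale1r => /sum_submodP[_ /ideal_smulP[r rm ->] h].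
  (* If [z] were in [m z + K], then [(1 - r) a^n], which is outside [m], would
     send [y] into [A]. *)
  have : (1 - r) *: z \in K by rewrite scalerBl scale1r.
  move/(stage_sub st); apply/negP; rewrite scalerA; apply: hy.
  apply/negP => /pm.2[rm'|]; last by apply/negP.
  by move/negP: pm.1; apply; rewrite -(subrK r 1); apply: rpredD.
exists (sum_submod A (cyclic_submod z)), (sum_submod (ideal_smul m z) K); split=> //.
split.
- by apply: fg_sum_submod; [exact: stage_fg st | exact: fg_span_submod].
- move=> x /sum_submodP[_ /ideal_smulP[r _ ->] h].
  rewrite -(subrK (r *: z) x); apply: rpredD; last exact: rpredZ.
  exact/AA'/(stage_sub st).
- by rewrite /= ms (stage_uniq st).
- move=> m'; rewrite inE => /predU1P[->|/(stage_ass st)].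
    by split=> //; exists z => // b; rewrite -colonP zm.
  exact: ass_in_ext.
- by move=> m'; rewrite inE => /predU1P[->//|/(stage_max st)].
- move=> m' mm'; rewrite inE negb_or => /andP[ne m's].
  have [c cm' cA] := stage_ann st mm' m's.
  have [b bm bm'] : exists2 b, b \in m & b \notin m'.
    by apply: maximal_neq_ex => //; rewrite eq_sym.
  exists (c * b); first by apply/negP => /(maximal_prime mm').2[]; apply/negP.
  move=> x /sum_submodP[w wA /cyclic_submodP[r e]].
  rewrite -(subrKC w x) e scalerDr; apply: rpredD.
    by rewrite mulrC -scalerA; apply/rpredZ/KK'/cA.
  rewrite scalerA.
  have -> : c * b * r = (c * r) * b by ring.
  by rewrite -scalerA; apply/rpredZ/zK'.
Qed.

(** If every stage could be extended, the union [L] of the submodules [K_k] would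
    meet each [A_k] in [K_k] only, so all the maximal ideals collected would be
    associated primes of [M/L]. *)
Lemma weakly_laskerian_finite_support : weakly_laskerian M ->
  exists A s, [/\ fg_submodule A, (forall m, m \in s -> maximal_ideal m) &
    forall m y, maximal_ideal m -> m \notin s ->
      exists2 c : R, c \notin m & c *: y \in A].
Proof.
move=> wl; apply: contrapT => no.
pose T := {t : submodule M * submodule M * seq (ideal R) | stage t.1.1 t.1.2 t.2}.
have next (t : T) : exists t' : T,
    [/\ size (sval t').2 = (size (sval t).2).+1,
      {subset (sval t).1.1 <= (sval t').1.1},
      {subset (sval t).1.2 <= (sval t').1.2} &
      forall x, x \in (sval t).1.1 -> x \in (sval t').1.2 -> x \in (sval t).1.2].
  case: t => -[[A K] s] /= st; apply: contrapT => stop; apply: no.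
  exists A, s; split=> [||m y mm ms]; [exact: stage_fg st|exact: stage_max st|].
  apply: contrapT => ny; apply: stop.
  have [|A' [K' [st' AA' KK' AK]]] := @stage_extend A K s m y st mm ms.
    by move=> c cm; apply/negP => cy; apply: ny; exists c.
  by exists (exist (fun t => stage t.1.1 t.1.2 t.2) (A', K', m :: s) st').
have [f hf] := choice next.
pose t k := iter k f (exist (fun t => stage t.1.1 t.1.2 t.2) (_, _, [::]) stage0).
pose A k := (sval (t k)).1.1; pose K k := (sval (t k)).1.2; pose s k := (sval (t k)).2.
have st k : stage (A k) (K k) (s k) := svalP (t k).
have As k : {subset A k <= A k.+1} by case: (hf (t k)).
have Ks k : {subset K k <= K k.+1} by case: (hf (t k)).
have AK k x : x \in A k -> x \in K k.+1 -> x \in K k.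
  by case: (hf (t k)) => _ _ _; exact.
have size_s k : size (s k) = k.
  by elim: k => // k IH; case: (hf (t k)) => -> _ _ _; rewrite IH.
have Kle n k : (n <= k)%N -> {subset K n <= K k}.
  move=> /subnK <-; elim: (k - n)%N => // j IH x /IH; exact: Ks.
have Ale n k : (n <= k)%N -> {subset A n <= A k}.
  move=> /subnK <-; elim: (k - n)%N => // j IH x /IH; exact: As.
have AKle n k x : x \in A n -> x \in K k -> x \in K n.
  move=> xA; elim: k => [|k IH]; first exact: Kle.
  have [kn|nk] := leqP k.+1 n; first exact: Kle.
  by move=> /(AK k _ (Ale n k nk x xA)); exact: IH.
have L0 : exists k, 0 \in K k by exists 0%N; exact: rpred0.
have LD (a : R) x y : (exists k, x \in K k) -> (exists k, y \in K k) ->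
    exists k, a *: x + y \in K k.
  move=> [i xi] [j yj]; exists (maxn i j).
  by apply: rpredZD; [exact: Kle (leq_maxl _ _) _ xi | exact: Kle (leq_maxr _ _) _ yj].
pose L := submod_of L0 LD.
have LE x : x \in L <-> exists k, x \in K k by exact: submod_ofP.
have [l hl] := (finite_seqP _).1 (wl L).
have sub k : {subset s k <= l}.
  move=> m ms; have : associated_primes (quotmod L) m.
    apply/ass_quotP; have [pm [x xA hx]] := stage_ass (st k) ms.
    split=> //; exists x => a; rewrite hx LE.
    split=> [h|[j]]; first by exists k.
    by apply: AKle; exact: rpredZ.
  by rewrite hl.
have := uniq_leq_size (stage_uniq (st (size l).+1)) (@sub _).
by rewrite size_s ltnn.
Qed.

End WL.

(** * Localization of minimax modules *)

Section Loc.
Variables (R : comPzRingType) (S : mulrClosed R) (M : lmodType R).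
Local Notation RS := (locring S).
Local Notation MS := (locmod S M).
Local Notation "x %/1" := (locfrac x (denom1 S) : MS) (at level 2, format "x %/1").
Implicit Types (Y : submodule MS) (N X : submodule M).

Definition locscalar (a : R) (s : denom S) : RS := locfrac (a : R^o) s.

Lemma locfracZ a s (x : M) t :
  locscalar a s *: (locfrac x t : MS) = locfrac (a *: x) (denomM s t).
Proof. exact: loc_scaleE. Qed.

Lemma locfrac_eq (x y : M) (s t : denom S) : sval t *: x = sval s *: y ->
  locfrac x s = locfrac y t.
Proof. by move=> e; apply/locfracP; exists 1; rewrite ?rpred1 // !mul1r. Qed.

Lemma locfrac_lin (a : R) (x y : M) :
  (a *: x + y)%/1 = locscalar a (denom1 S) *: x%/1 + y%/1.
Proof.
rewrite locfracZ locfracD; apply: locfrac_eq.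
by rewrite /= !mul1r !scale1r.
Qed.

Lemma locfrac0 (s : denom S) : (locfrac 0 s : MS) = 0.
Proof. by apply: locfrac_eq; rewrite !scaler0. Qed.

Lemma mem_locfrac Y (x : M) (s : denom S) : locfrac x s \in Y <-> x%/1 \in Y.
Proof.
split=> h.
  suff -> : x%/1 = locscalar (sval s) (denom1 S) *: locfrac x s by apply: rpredZ.
  by rewrite locfracZ; apply: locfrac_eq; rewrite /= mul1r !scale1r.
suff -> : locfrac x s = locscalar 1 s *: x%/1 by apply: rpredZ.
by rewrite locfracZ; apply: locfrac_eq; rewrite /= mulr1 scale1r.
Qed.

Fact contraction0 Y : (0 : M)%/1 \in Y.
Proof. by rewrite locfrac0 rpred0. Qed.

Fact contraction_closed Y (a : R) (x y : M) :
  x%/1 \in Y -> y%/1 \in Y -> (a *: x + y)%/1 \in Y.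
Proof. by move=> xY yY; rewrite locfrac_lin; apply: rpredZD. Qed.

Definition contraction Y : submodule M :=
  submod_of (contraction0 Y) (@contraction_closed Y).

Lemma contractionP Y x : x \in contraction Y <-> x%/1 \in Y.
Proof. exact: submod_ofP. Qed.

Fact extension0 X : exists x s, x \in X /\ (0 : MS) = locfrac x s.
Proof. by exists 0, (denom1 S); rewrite rpred0 locfrac0. Qed.

Fact extension_closed X (b : RS) (z w : MS) :
  (exists x s, x \in X /\ z = locfrac x s) ->
  (exists x s, x \in X /\ w = locfrac x s) ->
  exists x s, x \in X /\ b *: z + w = locfrac x s.
Proof.
move=> [x [s [xX ->]]] [y [t [yX ->]]]; have [a [r ->]] := locfrac_surj b.
rewrite -/(locscalar a r) locfracZ locfracD.
exists (sval t *: (a *: x) + sval (denomM r s) *: y), (denomM (denomM r s) t).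
by split=> //; rewrite rpredD ?rpredZ.
Qed.

Definition extension X : submodule MS := submod_of (extension0 X) (@extension_closed X).

Lemma extensionP X (x : M) s :
  locfrac x s \in extension X <-> exists2 c : R, c \in S & c *: x \in X.
Proof.
split=> [/submod_ofP[y [t [yX /locfracP[u uS e]]]]|[c cS cx]].
  exists (u * sval t); last by rewrite e rpredZ.
  by rewrite rpredM // (svalP t).
apply/submod_ofP; exists (c *: x), (denomM (exist _ c cS) s); split=> //.
by apply: locfrac_eq; rewrite /= scalerA mulrC.
Qed.

(** A submodule of the localization is determined by its contraction to [M], since
    [x / s] belongs to it as soon as [x / 1] does; so the chain condition is
    inherited. *)
Lemma minimax_loc : minimax M -> minimax MS.
Proof.
move=> /minimaxP[N [fN dN]]; have [n [g eN]] := fg_eq_span_submod fN.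
apply/minimaxP; exists (span_submod (fun i => (g i)%/1)).
split; first exact: fg_span_submod.
move=> Y NY Yd; have [||k hk] := dN (fun k => contraction (Y k)).
- by rewrite eN => k; apply: span_submod_sub => i; apply/contractionP/NY/mem_span_submod.
- by move=> k x /contractionP xY; apply/contractionP/Yd.
exists k => j kj z; have [x [s ->]] := locfrac_surj z.
by move=> /mem_locfrac/contractionP xY; apply/mem_locfrac/contractionP/hk.
Qed.

(** Numerators of generators of a submodule of the localization generate a
    submodule of [M] whose extension contains it. *)
Lemma minimax_local_dcc : minimax MS ->
  exists N : submodule M, fg_submodule N /\ local_dcc N (fun c : R => c \in S).
Proof.
move=> /minimaxP[N' [fN' dN']]; have [n [g eN]] := fg_eq_span_submod fN'.
pose h i := (repr (g i)).1; pose s i := (repr (g i)).2.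
have gh i : g i = locfrac (h i) (s i) by exact: locfrac_repr.
exists (span_submod h); split; first exact: fg_span_submod.
move=> X NX Xd; have [||k hk] := dN' (fun k => extension (X k)).
- rewrite eN => k; apply: span_submod_sub => i; rewrite gh; apply/extensionP.
  by exists 1; rewrite ?rpred1 // scale1r; apply/NX/mem_span_submod.
- move=> k z; have [x [t ->]] := locfrac_surj z => /extensionP[c cS cx].
  by apply/extensionP; exists c => //; exact: Xd.
exists k => j kj x xX; apply/(extensionP _ _ (denom1 S))/hk => //.
by apply/extensionP; exists 1; rewrite ?rpred1 // scale1r.
Qed.

End Loc.

(** * From local to global chain conditions *)

Section Glue.
Variables (R : comPzRingType) (hR : noetherian_ring R) (M : lmodType R).

Lemma local_dccW (N N' : submodule M) (S : R -> Prop) :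
  {subset N <= N'} -> local_dcc N S -> local_dcc N' S.
Proof. by move=> NN' dcc X N'X; apply: dcc => k x /NN'/N'X. Qed.

Lemma fg_local_dcc (A : submodule M) (s : seq (ideal R)) : fg_submodule A ->
  (forall m, m \in s -> exists N : submodule M,
    fg_submodule N /\ local_dcc N (fun c : R => c \notin m)) ->
  exists B, [/\ fg_submodule B, {subset A <= B} &
    forall m, m \in s -> local_dcc B (fun c : R => c \notin m)].
Proof.
move=> fA; elim: s => [_|m s IH hs]; first by exists A; split.
have [m' m's|B [fB AB hB]] := IH; first by apply: hs; rewrite inE m's orbT.
have [|N [fN hN]] := hs m; first exact: mem_head.
exists (sum_submod N B); split=> [|x /AB|m']; first exact: fg_sum_submod.
  exact: sub_sum_submodr.
rewrite inE => /predU1P[->|/hB].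
  exact: local_dccW (@sub_sum_submodl _ _ N B) hN.
exact: local_dccW (@sub_sum_submodr _ _ N B).
Qed.

(** Outside [s] the quotient [M/B] vanishes locally, so only finitely many maximal
    ideals impose an index from which the chain is locally constant, and the
    largest of these indices serves for all. *)
Lemma dcc_of_local (B : submodule M) (s : seq (ideal R)) :
  (forall m, m \in s -> local_dcc B (fun c : R => c \notin m)) ->
  (forall m x, maximal_ideal m -> m \notin s ->
    exists2 c : R, c \notin m & c *: x \in B) ->
  dcc_above B.
Proof.
move=> hs hB X BX Xd.
have [n hn] : exists n, forall m, m \in s -> forall k, (n <= k)%N ->
    forall x, x \in X n -> exists2 c : R, c \notin m & c *: x \in X k.
  elim: s hs {hB} => [|m s IH] hs; first by exists 0%N.
  have [m' m's|n hn] := IH; first by apply: hs; rewrite inE m's orbT.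
  have [|n' hn'] := hs m _ X BX Xd; first exact: mem_head.
  exists (maxn n n') => m'; rewrite inE => m's k; rewrite geq_max => /andP[nk n'k] x.
  case/predU1P: m's => [->|m's] xX.
    by apply: hn' => //; apply: chain_le xX => //; exact: leq_maxr.
  by apply: hn => //; apply: chain_le xX => //; exact: leq_maxl.
exists n => k nk x xX; apply: (local_global hR) => m mm.
have [ms|ms] := boolP (m \in s); first exact: (hn m ms k nk x xX).
by have [c cm cx] := hB m x mm ms; exists c => //; exact: BX.
Qed.
End Glue.

Theorem proposition2p2 (R : comPzRingType) (hR : noetherian_ring R)
    (M : lmodType R) :
  minimax M <->
  ((forall (m : ideal R) (hm : maximal_ideal m),
      minimax (locmod_at (maximal_prime hm) M)) /\
   weakly_laskerian M).
Proof.
split=> [mM|[mloc wl]].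
  by split=> [m hm|]; [exact: minimax_loc|exact: minimax_weakly_laskerian].
have [A [s [fA smax sA]]] := weakly_laskerian_finite_support hR wl.
have [m ms|B [fB AB sB]] := @fg_local_dcc R M A s fA.
  exact: (minimax_local_dcc (mloc m (smax m ms))).
apply/minimaxP; exists B; split=> //; apply: (dcc_of_local hR sB) => m x mm ms.
by have [c cm cx] := sA m x mm ms; exists c => //; exact: AB.
Qed.
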